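(* Let $(\mathcal{L},+,\cdot,0,1)$ be a semiring, let $k\ge1$ and $n\ge1$, and let $p_1,\dots,p_k,v_1,\dots,v_k$ be $2k$ pairwise distinct nonzero elements of $\mathcal{L}$ with $p_r\cdot p_r=p_r$ and $v_r\cdot v_r=v_r$ for all $r$; put $\mathcal{L}_{SP}=\{p_1,\dots,p_k,v_1,\dots,v_k\}$. Let $M_k$ be the $(k+1)\times(k+1)$ matrix whose first row is $(0,p_1,p_2,\dots,p_k)$, whose first column is $(0,v_1,\dots,v_k)^{T}$, and all of whose other entries are $0$; let $M_k^{(n)}=\bigoplus_{i=1}^n M_k$. For $1\le i\le k$ let $S_i=\begin{pmatrix}0&p_i\\ v_i&0\end{pmatrix}$ and $S^{(k)}=\bigoplus_{i=1}^k S_i$. Let $P=M_k^{(n)}\circ S^{(k)}$ be the matrix of the $n$-threaded program with $k$ binary semaphores. Then the program is deadlock free: in the directed graph on vertex set $\{1,\dots,o(P)\}$ having an edge $i\to j$ iff $P_{i,j}\neq 0$, every vertex reachable from the entry vertex $1$ has at least one outgoing edge (i.e. no row of $P$ indexed by a vertex reachable from vertex $1$ is a zero row).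
   Context: A semiring means: $(\mathcal{L},+,0)$ commutative monoid, $(\mathcal{L},\cdot,1)$ monoid, two-sided distributivity, $0$ absorbing for $\cdot$. Matrix addition is entrywise; $I_n$ is the identity matrix of order $n$. Kronecker product: for $A=(a_{i,j})$ of size $m\times n$ and $B=(b_{r,s})$ of size $p\times q$, $(A\otimes B)_{(i-1)p+r,(j-1)q+s}=a_{i,j}\cdot b_{r,s}$. Kronecker sum of square $A$ (order $m$) and $B$ (order $n$): $A\oplus B=A\otimes I_n+I_m\otimes B$; $k$-fold Kronecker sums are well defined by associativity. For a square matrix $M$ and a label $l$, $M_l$ is the matrix of the same order with entry $l$ wherever $M$ has entry $l$, and $0$ elsewhere. The operation $\circ$ is $T\circ S=\sum_{l\in\mathcal{L}_{SP}}(T_l\otimes S_l)+\sum_{l\in\mathcal{L}_{V}}(T_l\oplus S_l)$, where $\mathcal{L}_V$ is the set of non-synchronization labels (disjoint from $\mathcal{L}_{SP}$); here no such labels occur, so $P=\sum_{l\in\mathcal{L}_{SP}}\big((M_k^{(n)})_l\otimes (S^{(k)})_l\big)$. The matrix $P$ is viewed as the adjacency matrix of an automaton with entry node $1$; a deadlock is a node reachable from the entry node that has no successor (a zero row of $P$), and ''deadlock free'' means no such node exists. *)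

(* Defs.v *)
From HB Require Import structures.
From mathcomp Require Import all_boot all_order all_algebra.
From mathcomp.real_closed Require Import mxtens.

Set Implicit Arguments.
Unset Strict Implicit.
Unset Printing Implicit Defensive.

Import GRing.Theory.
Local Open Scope ring_scope.

(* Same formula as [mxtens.tensmx], which is only available over rings.
   [mxtens_unindex] inverts (i, r) |-> i * p + r, the 0-based form of
   (i, r) |-> (i - 1) p + r. *)
Definition kronmx (L : pzSemiRingType) (m n p q : nat)
    (A : 'M[L]_(m, n)) (B : 'M[L]_(p, q)) : 'M[L]_(m * p, n * q) :=
  \matrix_(i, j) (A (mxtens_unindex i).1 (mxtens_unindex j).1
                  * B (mxtens_unindex i).2 (mxtens_unindex j).2).

Definition kronsum (L : pzSemiRingType) (m n : nat)
    (A : 'M[L]_m) (B : 'M[L]_n) : 'M[L]_(m * n) :=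
  kronmx A 1%:M + kronmx 1%:M B.

(* [bigkronsum_order d n] is d ^ n, written so that it unfolds along
   [bigkronsum]. *)
Fixpoint bigkronsum_order (d n : nat) : nat :=
  if n is n'.+1 then (d * bigkronsum_order d n')%N else 1%N.

(* The empty Kronecker sum is the 1 x 1 zero matrix, the unit of [kronsum];
   in particular the sum of a one-element family is A ord0, up to the
   identification of orders d * 1 and d. *)
Fixpoint bigkronsum (L : pzSemiRingType) (d n : nat) :
    ('I_n -> 'M[L]_d) -> 'M[L]_(bigkronsum_order d n) :=
  match n with
  | 0 => fun _ => 0
  | n'.+1 => fun A => kronsum (A ord0) (bigkronsum (fun i => A (lift ord0 i)))
  end.

Definition label_mx (L : pzSemiRingType) (m n : nat) (l : L)
    (A : 'M[L]_(m, n)) : 'M[L]_(m, n) :=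
  \matrix_(i, j) (if A i j == l then l else 0).

(* T o S, for the sets of synchronization labels [LSP] and of
   non-synchronization labels [LV], both given as duplicate-free lists. *)
Definition sync (L : pzSemiRingType) (LSP LV : seq L) (m n : nat)
    (T : 'M[L]_m) (S : 'M[L]_n) : 'M[L]_(m * n) :=
  \sum_(l <- LSP) kronmx (label_mx l T) (label_mx l S)
  + \sum_(l <- LV) kronsum (label_mx l T) (label_mx l S).

Definition thread_mx (L : pzSemiRingType) (k : nat) (p v : 'I_k -> L) :
    'M[L]_(1 + k) :=
  block_mx 0               (\row_r p r)
           (\col_r v r)    0.

Definition semaphore_mx (L : pzSemiRingType) (p v : L) : 'M[L]_(1 + 1) :=
  block_mx 0               (const_mx p)
           (const_mx v)    0.

Definition sync_labels (L : pzSemiRingType) (k : nat) (p v : 'I_k -> L) :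
    seq L :=
  codom p ++ codom v.

Definition program_mx (L : pzSemiRingType) (k n : nat) (p v : 'I_k -> L) :=
  sync (sync_labels p v) [::]
       (bigkronsum (fun _ : 'I_n => thread_mx p v))
       (bigkronsum (fun i : 'I_k => semaphore_mx (p i) (v i))).

Definition edge (L : pzSemiRingType) (o : nat) (A : 'M[L]_o) : rel 'I_o :=
  fun i j => A i j != 0.

(* The entry node is the one of index 0; [connect] is the reflexive transitive
   closure. *)
Definition deadlock_free (L : pzSemiRingType) (o : nat) (A : 'M[L]_o) : Prop :=
  forall entry x : 'I_o, entry = 0%N :> nat -> connect (edge A) entry x ->
  exists y : 'I_o, edge A x y.

(* Main.v *)
(** A thread holds at most one semaphore, and along every path from the entry
    node each semaphore is locked exactly when precisely one thread holds it.
    In such a state, if some thread holds a semaphore then that thread can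
    release it; otherwise all semaphores are free and any thread can acquire
    any of them. *)
Require Import Defs.
From mathcomp Require Import all_boot all_order all_algebra.
From mathcomp.real_closed Require Import mxtens.
Local Open Scope ring_scope.
Import GRing.Theory.

Set Implicit Arguments.
Unset Strict Implicit.

(** * Local states of the components, as digits of an index *)

(** An index of an [n]-fold Kronecker sum encodes a tuple of local states, most significant digit
    first; [digit x i] is the state of component [i]. *)
Fixpoint digit (d n : nat) :
    'I_(bigkronsum_order d n) -> 'I_n -> 'I_d :=
  match n with
  | 0 => fun _ i => match notF (ltn_ord i) with end
  | n'.+1 => fun x i =>
      if unlift ord0 i is Some j then digit (mxtens_unindex x).2 j
      else (mxtens_unindex x).1
  end.

Lemma digit_ord0 d n (x : 'I_(bigkronsum_order d n.+1)) :
  digit x ord0 = (mxtens_unindex x).1.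
Proof. by rewrite /= unlift_none. Qed.

Lemma digit_lift d n (x : 'I_(bigkronsum_order d n.+1)) (j : 'I_n) :
  digit x (lift ord0 j) = digit (mxtens_unindex x).2 j.
Proof. by rewrite /= liftK. Qed.

Lemma mxtens_unindex_eq0 m n (x : 'I_(m * n)) : x = 0%N :> nat ->
  (mxtens_unindex x).1 = 0%N :> nat /\ (mxtens_unindex x).2 = 0%N :> nat.
Proof. by move=> x0; rewrite /= x0 div0n mod0n. Qed.

Lemma digit_eq0 d n (x : 'I_(bigkronsum_order d n)) (i : 'I_n) :
  x = 0%N :> nat -> digit x i = 0%N :> nat.
Proof.
elim: n x i => [x [] //|n IHn x i /mxtens_unindex_eq0[x1 x2]].
case: (unliftP ord0 i) => [j ->|->]; last by rewrite digit_ord0.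
by rewrite digit_lift IHn.
Qed.

(** * Entries of iterated Kronecker sums *)

Section KroneckerSums.

Variables (L : pzSemiRingType) (d : nat).

Lemma kronsumE m n (A : 'M[L]_m) (B : 'M[L]_n) x y :
  kronsum A B x y =
    A (mxtens_unindex x).1 (mxtens_unindex y).1
      *+ ((mxtens_unindex x).2 == (mxtens_unindex y).2)
    + B (mxtens_unindex x).2 (mxtens_unindex y).2
      *+ ((mxtens_unindex x).1 == (mxtens_unindex y).1).
Proof. by rewrite !mxE mulr_natr mulr_natl. Qed.

Lemma bigkronsum_diag n (A : 'I_n -> 'M[L]_d) x :
  (forall i c, A i c c = 0) -> bigkronsum A x x = 0.
Proof.
elim: n A x => [|n IHn] A x A0; first by rewrite mxE.
by rewrite kronsumE A0 IHn ?mul0rn ?addr0.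
Qed.

(** The identity factors freeze all components but one. With zero diagonals, at most one summand of
    each [kronsum] survives, so a nonzero entry is a single entry of some [A i] and never a proper
    sum of labels. *)
Lemma bigkronsum_neq0 n (A : 'I_n -> 'M[L]_d) x y :
    (forall i c, A i c c = 0) -> bigkronsum A x y != 0 ->
  exists i, (forall j, j != i -> digit x j = digit y j) /\
            bigkronsum A x y = A i (digit x i) (digit y i).
Proof.
elim: n A x y => [|n IHn] A x y A0; first by rewrite mxE eqxx.
(* If the tails agree, the tail summand is a diagonal entry, hence zero, and component [ord0] is the
   one that moves. *)
rewrite kronsumE; case: (eqVneq (mxtens_unindex x).2) => [e2|_].
  rewrite e2 bigkronsum_diag // mul0rn addr0 => _.
  exists ord0; split=> [j|]; last by rewrite !digit_ord0.
  by case: (unliftP ord0 j) => [i ->|-> /eqP//]; rewrite !digit_lift e2.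
case: (eqVneq (mxtens_unindex x).1) => [e1|_]; last by rewrite addr0 eqxx.
rewrite mulr0n add0r => /IHn[//|i [xy ->]].
exists (lift ord0 i); split=> [j|]; last by rewrite !digit_lift.
case: (unliftP ord0 j) => [i' ->|-> _]; last by rewrite !digit_ord0.
by rewrite (inj_eq lift_inj) !digit_lift; apply: xy.
Qed.

(** The witness [y] is [x] with its digit [i] replaced by [c]. *)
Lemma bigkronsum_move n (A : 'I_n -> 'M[L]_d) x i c :
    (forall i c, A i c c = 0) ->
  exists y, bigkronsum A x y = A i (digit x i) c.
Proof.
elim: n A x i => [? ? [] //|n IHn] A x i A0.
case: (unliftP ord0 i) => [j ->|->].
  have [y yE] := IHn _ (mxtens_unindex x).2 j (fun i => A0 (lift ord0 i)).
  exists (mxtens_index ((mxtens_unindex x).1, y)).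
  by rewrite kronsumE mxtens_indexK A0 mul0rn add0r eqxx digit_lift -yE.
exists (mxtens_index (c, (mxtens_unindex x).2)).
rewrite kronsumE mxtens_indexK digit_ord0 eqxx.
by rewrite bigkronsum_diag ?mul0rn ?addr0.
Qed.

End KroneckerSums.

(** * Entries of the synchronized product *)

Lemma sync_neq0P (L : pzSemiRingType) (LSP : seq L) m n
    (T : 'M[L]_m) (S : 'M[L]_n) x y :
    uniq LSP -> {in LSP, forall l, l != 0} -> {in LSP, forall l, l * l = l} ->
  reflect (T (mxtens_unindex x).1 (mxtens_unindex y).1
             = S (mxtens_unindex x).2 (mxtens_unindex y).2
           /\ T (mxtens_unindex x).1 (mxtens_unindex y).1 \in LSP)
          (sync LSP [::] T S x y != 0).
Proof.
move=> LSPu LSP0 LSPi; rewrite /sync big_nil addr0 summxE.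
set t := T _ _; set s := S _ _.
(* By idempotence a summand is [l * l = l] when both entries are [l], and it is [0] otherwise; only
   [l = t] can contribute, and [uniq] makes it occur at most once. *)
have -> : \sum_(l <- LSP) kronmx (label_mx l T) (label_mx l S) x y
          = \sum_(l <- LSP | l == t) (if l == s then l else 0).
  rewrite [RHS]big_mkcond /=; apply: eq_big_seq => l l_in.
  rewrite !mxE -/t -/s (eq_sym t) (eq_sym s).
  case: (l == t); last by rewrite mul0r.
  by case: (l == s); rewrite ?LSPi ?mulr0.
rewrite -big_filter; apply: (iffP idP) => [|[<- t_in]].
  case t_in: (t \in LSP); last first.
    rewrite (_ : [seq _ <- _ | _] = [::]) ?big_nil ?eqxx //.
    by apply/eqP; rewrite -[_ == _ :> seq _]negbK -has_filter has_pred1 t_in.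
  by rewrite filter_pred1_uniq // big_seq1; case: (eqVneq t s); rewrite ?eqxx.
by rewrite filter_pred1_uniq // big_seq1 eqxx LSP0.
Qed.

(** * Moves of a single thread and of a single semaphore *)

Section Program.

Variables (L : pzSemiRingType) (k : nat) (p v : 'I_k -> L).

Lemma thread_mx_diag c : thread_mx p v c c = 0.
Proof.
by rewrite -[c]splitK; case: split => r /=;
  rewrite ?block_mxEul ?block_mxEdr mxE.
Qed.

Lemma semaphore_mx_diag (a b : L) c : semaphore_mx a b c c = 0.
Proof.
by rewrite -[c]splitK; case: split => r /=;
  rewrite ?block_mxEul ?block_mxEdr mxE.
Qed.

Lemma thread_mx_acquire (c : 'I_(1 + k)) r :
  c = 0%N :> nat -> thread_mx p v c (rshift 1 r) = p r.
Proof.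
move=> c0; have -> : c = lshift k ord0 by apply: val_inj.
by rewrite block_mxEur mxE.
Qed.

Lemma thread_mx_release r : thread_mx p v (rshift 1 r) (lshift k ord0) = v r.
Proof. by rewrite block_mxEdl mxE. Qed.

Lemma semaphore_mx_acquire (a b : L) (c : 'I_(1 + 1)) :
  c = 0%N :> nat -> semaphore_mx a b c (rshift 1 ord0) = a.
Proof.
move=> c0; have -> : c = lshift 1 ord0 by apply: val_inj.
by rewrite block_mxEur mxE.
Qed.

Lemma semaphore_mx_release (a b : L) (c : 'I_(1 + 1)) :
  c = 1%N :> nat -> semaphore_mx a b c (lshift 1 ord0) = b.
Proof.
move=> c1; have -> : c = rshift 1 ord0 by apply: val_inj.
by rewrite block_mxEdl mxE.
Qed.

Lemma thread_mx_neq0 (c c' : 'I_(1 + k)) : thread_mx p v c c' != 0 ->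
  exists r : 'I_k,
    [/\ c = 0%N :> nat, c' = r.+1 :> nat & thread_mx p v c c' = p r] \/
    [/\ c = r.+1 :> nat, c' = 0%N :> nat & thread_mx p v c c' = v r].
Proof.
rewrite -[c]splitK -[c']splitK; case: split => r; case: split => r' /=.
- by rewrite block_mxEul mxE eqxx.
- by exists r'; left; rewrite block_mxEur mxE (ord1 r).
- by exists r; right; rewrite block_mxEdl mxE (ord1 r').
- by rewrite block_mxEdr mxE eqxx.
Qed.

Lemma semaphore_mx_neq0 (a b : L) (c c' : 'I_(1 + 1)) :
    semaphore_mx a b c c' != 0 ->
  [/\ c = 0%N :> nat, c' = 1%N :> nat & semaphore_mx a b c c' = a] \/
  [/\ c = 1%N :> nat, c' = 0%N :> nat & semaphore_mx a b c c' = b].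
Proof.
rewrite -[c]splitK -[c']splitK; case: split => r; case: split => r' /=.
- by rewrite block_mxEul mxE eqxx.
- by left; rewrite block_mxEur mxE (ord1 r) (ord1 r').
- by right; rewrite block_mxEdl mxE (ord1 r) (ord1 r').
- by rewrite block_mxEdr mxE eqxx.
Qed.

Hypothesis labels_distinct : uniq (sync_labels p v).

Lemma acquire_inj : injective p.
Proof.
by move: labels_distinct; rewrite cat_uniq => /andP[/injectiveP].
Qed.

Lemma release_inj : injective v.
Proof.
by move: labels_distinct; rewrite cat_uniq => /and3P[_ _ /injectiveP].
Qed.

Lemma acquire_neq_release r r' : p r <> v r'.
Proof.
move=> prv; move: labels_distinct; rewrite cat_uniq => /and3P[_ /hasPn nb _].
by have := nb _ (codom_f v r'); rewrite /= -prv codom_f.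
Qed.

(** * The invariant, its preservation, and progress *)

Section Invariant.

Variable n : nat.

(** Node [0] of a thread is idle; node [r.+1] means that it holds semaphore [r]. *)
Definition holders (x : 'I_(bigkronsum_order (1 + k) n)) (r : 'I_k) : nat :=
  \sum_(i < n) (digit x i == r.+1 :> nat).

(** A semaphore digit is [0] when free and [1] when locked, so this equality also encodes mutual
    exclusion. *)
Definition consistent
    (w : 'I_(bigkronsum_order (1 + k) n * bigkronsum_order (1 + 1) k)) :=
  forall r, holders (mxtens_unindex w).1 r
            = digit (mxtens_unindex w).2 r :> nat.

(** The balance is written crosswise to avoid truncated subtraction. *)
Lemma holders_change (x y : 'I_(bigkronsum_order (1 + k) n)) i r :
    (forall j, j != i -> digit x j = digit y j) ->
  (holders x r + (digit y i == r.+1 :> nat)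
   = holders y r + (digit x i == r.+1 :> nat))%N.
Proof.
move=> xy; rewrite /holders (bigD1 i) //= [X in (_ = X + _)%N](bigD1 i) //=.
rewrite (eq_bigr (fun j => (digit y j == r.+1 :> nat) : nat)); last first.
  by move=> j /xy->.
by rewrite addnAC [RHS]addnAC; congr (_ + _)%N; apply: addnC.
Qed.

Lemma consistent_entry
    (w : 'I_(bigkronsum_order (1 + k) n * bigkronsum_order (1 + 1) k)) :
  w = 0%N :> nat -> consistent w.
Proof.
move=> /mxtens_unindex_eq0[w1 w2] r.
by rewrite digit_eq0 // /holders big1 // => i _; rewrite digit_eq0.
Qed.

Hypothesis p_neq0 : forall r, p r != 0.
Hypothesis v_neq0 : forall r, v r != 0.
Hypothesis p_idem : forall r, p r * p r = p r.
Hypothesis v_idem : forall r, v r * v r = v r.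

Let M := bigkronsum (fun _ : 'I_n => thread_mx p v).
Let S := bigkronsum (fun i : 'I_k => semaphore_mx (p i) (v i)).

Lemma label_neq0 l : l \in sync_labels p v -> l != 0.
Proof. by rewrite mem_cat => /orP[]/codomP[r ->]. Qed.

Lemma program_edgeP w w' :
  reflect (M (mxtens_unindex w).1 (mxtens_unindex w').1
             = S (mxtens_unindex w).2 (mxtens_unindex w').2
           /\ M (mxtens_unindex w).1 (mxtens_unindex w').1
                \in sync_labels p v)
          (edge (program_mx n p v) w w').
Proof.
apply: sync_neq0P => // l; first exact: label_neq0.
by rewrite mem_cat => /orP[]/codomP[r ->].
Qed.

(** An edge moves exactly one thread and one semaphore under a common label. Distinctness of the
    labels forces both moves to concern the same semaphore and to have the same direction, so its
    count and its digit change together. *)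
Lemma consistent_edge w w' :
  edge (program_mx n p v) w w' -> consistent w -> consistent w'.
Proof.
move=> /program_edgeP[]; rewrite /consistent.
move: (mxtens_unindex w) (mxtens_unindex w') => [x s] [y t] /= MS /label_neq0.
move=> M0 xs r; have S0 := M0; rewrite MS in S0.
have [i [xy Mi]] := bigkronsum_neq0 (fun=> thread_mx_diag) M0.
have [j [st Sj]] := bigkronsum_neq0 (fun i => @semaphore_mx_diag _ _) S0.
have := holders_change r xy; rewrite xs.
have {xy M0} : thread_mx p v (digit x i) (digit y i) != 0 by rewrite -Mi.
have {S0} : semaphore_mx (p j) (v j) (digit s j) (digit t j) != 0.
  by rewrite -Sj.
have {MS Mi Sj} : thread_mx p v (digit x i) (digit y i)
    = semaphore_mx (p j) (v j) (digit s j) (digit t j) by rewrite -Mi MS.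
move=> e /semaphore_mx_neq0 S0 /thread_mx_neq0[r' M0]; move: e.
(* Acquire or release on each side: the two mixed cases would equate some [p] label with some [v]
   label. *)
case: M0 => -[-> -> ->]; case: S0 => -[sj tj ->].
- move=> /acquire_inj->; rewrite addn0 => <-.
  case: (eqVneq r j) => [->|rj]; first by rewrite sj tj eqxx.
  by rewrite st // eqSS eq_sym (inj_eq val_inj) (negPf rj) addn0.
- by move=> /acquire_neq_release.
- by move=> /esym/acquire_neq_release.
- move=> /release_inj->; rewrite addn0.
  case: (eqVneq r j) => [->|rj].
    by rewrite sj tj eqxx addn1 => -[].
  by rewrite st // eqSS eq_sym (inj_eq val_inj) (negPf rj) addn0 => ->.
Qed.

Lemma consistent_connect w w' :
  connect (edge (program_mx n p v)) w w' -> consistent w -> consistent w'.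
Proof.
case/connectP=> s + ->; elim: s w => //= w1 s IHs w /andP[ww1 /IHs{}IHs] cw.
exact/IHs/(consistent_edge ww1).
Qed.

Lemma consistent_progress w : (0 < k)%N -> (0 < n)%N ->
  consistent w -> exists w', edge (program_mx n p v) w w'.
Proof.
move=> k_gt0 n_gt0 cw.
(* Local moves of thread [i] and semaphore [r] carrying the same label combine into an edge of the
   program. *)
have join i r c c' l : l \in sync_labels p v ->
    thread_mx p v (digit (mxtens_unindex w).1 i) c = l ->
    semaphore_mx (p r) (v r) (digit (mxtens_unindex w).2 r) c' = l ->
  exists w', edge (program_mx n p v) w w'.
  move=> l_in Tl Sl.
  have [y yE] := bigkronsum_move (mxtens_unindex w).1 i c
                   (fun=> thread_mx_diag).
  have [t tE] := bigkronsum_move (mxtens_unindex w).2 r c'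
                   (fun i => @semaphore_mx_diag (p i) (v i)).
  exists (mxtens_index (y, t)); apply/program_edgeP.
  by rewrite mxtens_indexK /M /S yE tE Tl Sl.
case: (pickP (fun i => digit (mxtens_unindex w).1 i != 0%N :> nat))
  => [i xi|x0]; last first.
  (* All threads are idle, so every count is zero and every semaphore is free; the first thread can
     acquire the first semaphore. *)
  pose r := Ordinal k_gt0; pose i := Ordinal n_gt0.
  have {}x0 j : digit (mxtens_unindex w).1 j = 0%N :> nat.
    by have /negbFE/eqP := x0 j.
  apply: (@join i r (rshift 1 r) (rshift 1 ord0) (p r)).
  - by rewrite mem_cat codom_f.
  - exact: thread_mx_acquire.
  - apply: semaphore_mx_acquire; rewrite -cw /holders big1 // => j _.
    by rewrite x0.
have [r xr] : exists r, digit (mxtens_unindex w).1 i = rshift 1 r.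
  move: xi; rewrite -[digit _ i]splitK; case: split => [z|r _]; last by exists r.
  by rewrite (ord1 z).
apply: (@join i r (lshift k ord0) (lshift 1 ord0) (v r)).
- by rewrite mem_cat codom_f orbT.
- by rewrite xr thread_mx_release.
(* The digit is at most [1] by its type, and at least [1] because thread [i] already contributes [1]
   to the count. *)
- apply: semaphore_mx_release; apply/eqP; rewrite eqn_leq -ltnS ltn_ord /=.
  by rewrite -cw /holders (bigD1 i) //= xr eqxx.
Qed.

End Invariant.

End Program.

Theorem theorem1 (L : pzSemiRingType) (k n : nat) (p v : 'I_k -> L)
    (k_ge1 : (1 <= k)%N) (n_ge1 : (1 <= n)%N)
    (labels_distinct : uniq (sync_labels p v))
    (p_neq0 : forall r : 'I_k, p r != 0)
    (v_neq0 : forall r : 'I_k, v r != 0)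
    (p_idem : forall r : 'I_k, p r * p r = p r)
    (v_idem : forall r : 'I_k, v r * v r = v r) :
  deadlock_free (program_mx n p v).
Proof.
move=> entry w entry0 /consistent_connect cw.
by apply: consistent_progress => //; apply: cw => //; apply: consistent_entry.
Qed.
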